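(* Let $G$ be a finite group of odd order $k$. Let $\psi_j$ be the Adams endomorphisms of the representation ring $R(G)_{\mathbb Z}$. Then the wedge operation $\wedge: R(G)_{\mathbb Z}\to R(G)_{\mathbb C}$ is given, for all $x\in R(G)_{\mathbb Z}$, by the formula $$\wedge(x)=e^{\sum_{j=1}^k c_j\psi_j(x)},\qquad c_j=(-1)^{j+1}\frac{H(j/k)}{k},$$ where $H(u)=\sum_{m=0}^{\infty}\frac{(-1)^m}{m+u}$ for $u>0$.
   Context: $R(G)_{\mathbb Z}$ is the ring of virtual finite dimensional complex representations of $G$, and $R(G)_{\mathbb C}=R(G)_{\mathbb Z}\otimes_{\mathbb Z}\mathbb C$ is identified via characters with the ring $C(G)$ of complex valued class functions on $G$ under pointwise operations; the exponential is computed pointwise in $C(G)$. The Adams operation $\psi_j$ acts on class functions by $\psi_j(f)(g)=f(g^j)$. For a finite dimensional representation $\pi$ of $G$ on $E$, $\wedge\pi$ is the representation of $G$ on $\bigoplus_{n\ge0}\wedge^nE$. When $G$ has odd order, $\pi\mapsto\wedge\pi$ extends uniquely to a morphism $\wedge$ from the additive group $R(G)_{\mathbb Z}$ to the multiplicative monoid $R(G)_{\mathbb C}$ (so $\wedge(x+y)=\wedge(x)\wedge(y)$, $\wedge(0)=1$); this extension is the wedge operation of the claim. *)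

(* Defs.v *)
From HB Require Import structures.
From mathcomp Require Import all_boot all_order all_algebra.
From mathcomp Require Import all_fingroup all_solvable all_character.
From mathcomp Require Import boolp classical_sets reals topology normedtype.
From mathcomp Require Import sequences exp trigo.
From mathcomp Require Import complex ring.
Set Implicit Arguments.
Unset Strict Implicit.
Unset Printing Implicit Defensive.
Import Order.TTheory GRing.Theory Num.Theory.
Import numFieldNormedType.Exports.
Local Open Scope ring_scope.

(* Vectors of E = F^d are row vectors, linear maps act on the right (as in    *)
(* mxrepresentation), and an m-tuple of vectors of E is an m x d matrix.      *)
Section AlternatingMaps.
Variables (F : fieldType) (m d : nat) (U : lmodType F).
Implicit Types (f : 'M[F]_(m, d) -> U) (A : 'M[F]_(m, d)).

Definition multilinear f := forall A B C i0 (b c : F),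
  row i0 A = b *: row i0 B + c *: row i0 C ->
  row' i0 B = row' i0 A -> row' i0 C = row' i0 A -> f A = b *: f B + c *: f C.

Definition alternating f := forall A i1 i2, i1 != i2 -> A i1 =1 A i2 -> f A = 0.

End AlternatingMaps.

Section ExteriorPower.
Variables (F : fieldType) (d m : nat).

(* The exterior power of degree m of F^d is 'rV_ext_dim, with basis the       *)
(* e_S = e_s1 /\ ... /\ e_sm, for S = {s1 < ... < sm} in {0, ..., d-1};       *)
(* mcol S lists the elements of S in increasing order.                        *)
Definition msub := {S : {set 'I_d} | #|S| == m}.
Definition mcol (S : msub) (i : 'I_m) : 'I_d :=
  enum_val (cast_ord (esym (eqP (valP S))) i).
Definition ext_dim := #|{: msub}|.

(* v_1 /\ ... /\ v_m in the basis (e_S); lemma wedgev_universal below is the  *)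
(* universal property of the exterior power.                                  *)
Definition wedgev (v : 'M[F]_(m, d)) : 'rV[F]_ext_dim :=
  \row_s \det (colsub (mcol (enum_val s)) v).

(* The tuple (e_s1, ..., e_sm). *)
Definition basis_rows (S : msub) : 'M[F]_(m, d) := rowsub (mcol S) 1%:M.

(* The linear map induced by A, e_S |-> (e_s1 A) /\ ... /\ (e_sm A); lemma     *)
(* wedgev_mul below extends this formula to all m-tuples of vectors.          *)
Definition extmx (A : 'M[F]_d) : 'M[F]_ext_dim :=
  \matrix_s wedgev (basis_rows (enum_val s) *m A).

Lemma mcol_inj S : injective (mcol S).
Proof. by move=> i j /enum_val_inj /cast_ord_inj. Qed.

Lemma mcol_in S i : mcol S i \in val S.
Proof. exact: enum_valP. Qed.

Lemma mcolP (S : msub) x : x \in val S -> {i | mcol S i = x}.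
Proof.
move=> xS; exists (cast_ord (eqP (valP S)) (enum_rank_in xS x)).
by rewrite /mcol cast_ordK enum_rankK_in.
Qed.

Lemma mcol_mono S (i j : 'I_m) : (i < j)%N -> (mcol S i < mcol S j)%N.
Proof.
move=> lt_ij; rewrite /mcol.
have srt : sorted (fun x y : 'I_d => (x < y)%N) (enum (val S)).
  rewrite /enum_mem; apply: sorted_filter; first by move=> ? ? ?; apply: ltn_trans.
  have := iota_ltn_sorted 0 d; rewrite -val_enum_ord sorted_map enumT.
  by apply: sub_sorted.
have tr : transitive (fun x y : 'I_d => (x < y)%N) by move=> ? ? ?; apply: ltn_trans.
have x0 : 'I_d by exact: mcol S i.
rewrite !(enum_val_nth x0).
apply: (sorted_ltn_nth tr x0 srt) => /=; last exact: lt_ij.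
  by rewrite inE -cardE (eqP (valP S)) ltn_ord.
by rewrite inE -cardE (eqP (valP S)) ltn_ord.
Qed.

Lemma wedgev_multilinear : multilinear wedgev.
Proof.
move=> A B C i0 b c hA hB hC; apply/rowP=> s; rewrite !mxE.
have rs (M : 'M[F]_(m, d)) g : row i0 (colsub g M) = colsub g (row i0 M) :> 'rV_m.
  by apply/rowP=> j; rewrite !mxE.
have rs' (M : 'M[F]_(m, d)) g : row' i0 (colsub g M) = colsub g (row' i0 M) :> 'M_(_,m).
  by apply/matrixP=> i j; rewrite !mxE.
apply: (@determinant_multilinear _ _ _ _ _ i0); rewrite ?rs ?rs' ?hB ?hC // hA.
by apply/rowP=> j; rewrite !mxE.
Qed.

Lemma wedgev_alternating : alternating wedgev.
Proof.
move=> A i1 i2 neq eqA; apply/rowP=> s; rewrite !mxE.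
by apply: (determinant_alternate neq) => j; rewrite !mxE eqA.
Qed.

Lemma wedgev_basis s : wedgev (basis_rows (enum_val s)) = delta_mx 0 s.
Proof.
apply/rowP=> t; rewrite !mxE /=; have [->|neq] := eqVneq t s.
  suff -> : colsub (mcol (enum_val s)) (basis_rows (enum_val s)) = 1%:M.
    by rewrite det1.
  by apply/matrixP=> i j; rewrite !mxE (inj_eq (@mcol_inj _)).
have /subsetPn[x xs xt] : ~~ (val (enum_val s) \subset val (enum_val t)).
  apply: contra neq => sst; apply/eqP/enum_val_inj/val_inj/esym/eqP.
  by rewrite eqEcard sst (eqP (valP (enum_val s))) (eqP (valP (enum_val t))) leqnn.
have [i def_x] := mcolP xs.
rewrite (expand_det_row _ i) big1 // => j _; rewrite !mxE def_x.
case: eqP => [eq_x|]; last by rewrite mul0r.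
by case/negP: xt; rewrite eq_x mcol_in.
Qed.

Section Vanish.
Variables (U : lmodType F) (f : 'M[F]_(m, d) -> U).
Hypotheses (fL : multilinear f) (fA : alternating f).

Definition setrow k (u : 'rV[F]_d) (A : 'M[F]_(m, d)) : 'M[F]_(m, d) :=
  \matrix_(i, j) if i == k then u 0 j else A i j.

Lemma row_setrow k u A : row k (setrow k u A) = u.
Proof. by apply/rowP=> j; rewrite !mxE eqxx. Qed.

Lemma row'_setrow k u A : row' k (setrow k u A) = row' k A.
Proof. by apply/matrixP=> i j; rewrite !mxE eq_sym (negPf (neq_lift _ _)). Qed.

Lemma fsetrow k A a b u w :
  f (setrow k (a *: u + b *: w) A) = a *: f (setrow k u A) + b *: f (setrow k w A).
Proof. by apply: (fL (i0 := k)); rewrite ?row_setrow ?row'_setrow. Qed.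

Lemma fsetrow_sum k A (u : 'rV[F]_d) :
  f (setrow k u A) = \sum_j u 0 j *: f (setrow k (delta_mx 0 j) A).
Proof.
rewrite {1}[u]row_sum_delta.
elim/big_rec2: _ => [|j y x _ <-].
  by have := fsetrow k A 0 0 0 0; rewrite !scale0r !addr0.
by rewrite -[in LHS](scale1r x) fsetrow scale1r.
Qed.

Lemma fsetrowD k A u w :
  f (setrow k (u + w) A) = f (setrow k u A) + f (setrow k w A).
Proof. by have := fsetrow k A 1 1 u w; rewrite !scale1r. Qed.

Lemma f_swap A i1 i2 : i1 != i2 -> f (xrow i1 i2 A) = - f A.
Proof.
move=> neq.
pose M u w := setrow i1 u (setrow i2 w A).
have M0 u : f (M u u) = 0.
  by apply: (fA neq) => j; rewrite !mxE eqxx eq_sym (negPf neq) eqxx.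
have MC u w : M u w = setrow i2 w (setrow i1 u A).
  apply/matrixP=> i j; rewrite !mxE.
  by case: (i =P i1) => // ->; rewrite (negPf neq).
have MDl u v w : f (M (u + v) w) = f (M u w) + f (M v w) by apply: fsetrowD.
have MDr u v w : f (M w (u + v)) = f (M w u) + f (M w v).
  by rewrite !MC fsetrowD.
have := M0 (row i1 A + row i2 A); rewrite MDl !MDr !M0 add0r addr0.
have -> : M (row i1 A) (row i2 A) = A.
  by apply/matrixP=> i j; rewrite !mxE; case: eqP => [->|_]; last case: eqP => [->|].
have -> : M (row i2 A) (row i1 A) = xrow i1 i2 A.
  apply/matrixP=> i j; rewrite !mxE; case: tpermP => [->|->|/eqP n1 /eqP n2].
  - by rewrite eqxx.
  - by rewrite eq_sym (negPf neq) eqxx.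
  - by rewrite (negPf n1) (negPf n2).
by move/eqP; rewrite addrC addr_eq0 => /eqP.
Qed.

Lemma f_row_perm (s : 'S_m) A : f A = 0 -> f (row_perm s A) = 0.
Proof.
have [ts -> ts_d] := prod_tpermP s => fA0; elim: ts ts_d => [|t ts IH] /=.
  by rewrite big_nil row_perm1.
case/andP=> t_d /IH f0; rewrite big_cons row_permM.
by have := @f_swap (row_perm (\prod_(t0 <- ts) tperm t0.1 t0.2)%g A) _ _ t_d;
   rewrite f0 oppr0.
Qed.

Hypothesis f0 : forall S, f (basis_rows S) = 0.

Lemma alternating_eq0 A : f A = 0.
Proof.
pose is_basis (B : 'M[F]_(m, d)) i := exists j, row i B = delta_mx 0 j.
suff fk k B : (forall i : 'I_m, (k <= i)%N -> is_basis B i) -> f B = 0.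
  by apply: (fk m) => i; rewrite leqNgt ltn_ord.
elim: k B => [|k IHk] B HB; last first.
  have [lt_km|le_mk] := ltnP k m; last first.
    by apply: IHk => i; rewrite leqNgt (leq_trans (ltn_ord i) le_mk).
  pose k' := Ordinal lt_km.
  have -> : B = setrow k' (row k' B) B.
    by apply/matrixP=> i j; rewrite !mxE; case: eqP => [->|].
  rewrite fsetrow_sum big1 // => j _; rewrite IHk ?scaler0 // => i le_ki.
  have [->|neq] := eqVneq i k'; first by exists j; rewrite row_setrow.
  have [|l rowl] := HB i; first by rewrite ltn_neqAle le_ki andbT eq_sym.
  exists l; rewrite -rowl; apply/rowP=> x; rewrite !mxE.
  by rewrite (negPf neq).
have {HB} /fin_all_exists[phi HB] : forall i, is_basis B i by move=> i; apply: HB.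
have {HB} -> : B = rowsub phi 1%:M.
  by apply/row_matrixP=> i; rewrite HB rowE -rowE row_rowsub row1.
have [phi_inj|] := boolP (injectiveb phi); last first.
  case/injectivePn=> i1 [i2 neq eq_phi].
  by apply: (fA neq) => j; rewrite !mxE eq_phi.
move/injectiveP in phi_inj.
have Sm : #|[set phi i | i in predT]| == m by rewrite card_imset // card_ord.
pose S : msub := Sub [set phi i | i in predT] Sm.
have memS i : phi i \in val S by apply: imset_f.
pose s0 i := sval (mcolP (memS i)).
have s0E i : mcol S (s0 i) = phi i by apply: (svalP (mcolP (memS i))).
have s0_inj : injective s0.
  by move=> i j eq_ij; apply: phi_inj; rewrite -!s0E eq_ij.
have -> : rowsub phi 1%:M = row_perm (perm s0_inj) (basis_rows S).
  by apply/matrixP=> i j; rewrite !mxE permE s0E.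
exact: f_row_perm.
Qed.

End Vanish.

Section Universal.
Variables (U : lmodType F) (f : 'M[F]_(m, d) -> U).
Hypotheses (fL : multilinear f) (fA : alternating f).

Lemma alternating_expand v :
  f v = \sum_s wedgev v 0 s *: f (basis_rows (enum_val s)).
Proof.
apply/eqP; rewrite -subr_eq0; apply/eqP; move: v.
apply: alternating_eq0.
- move=> A B C i0 b c hA hB hC; rewrite (fL hA hB hC).
  rewrite (wedgev_multilinear hA hB hC) !scalerBr !scaler_sumr.
  rewrite addrACA -opprD -big_split /=; congr (_ - _).
  by apply: eq_bigr => s _; rewrite !mxE scalerDl !scalerA.
- move=> A i1 i2 neq eqA; rewrite (fA neq eqA) (wedgev_alternating neq eqA).
  by rewrite big1 ?subr0 // => s _; rewrite mxE scale0r.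
move=> S; rewrite (bigD1 (enum_rank S)) //= enum_rankK.
rewrite -[in wedgev _](enum_rankK S) wedgev_basis mxE !eqxx scale1r.
rewrite big1 ?addr0 ?enum_rankK ?subrr // => s neq.
by rewrite mxE (negPf neq) scale0r.
Qed.

Lemma wedgev_universal :
  exists2 h : {linear 'rV[F]_ext_dim -> U}, (forall v, f v = h (wedgev v))
    & forall h' : {linear 'rV[F]_ext_dim -> U},
        (forall v, f v = h' (wedgev v)) -> h' =1 h.
Proof.
pose h0 (u : 'rV[F]_ext_dim) := \sum_s u 0 s *: f (basis_rows (enum_val s)).
have h0L : linear h0.
  move=> a u w; rewrite /h0 scaler_sumr -big_split /=.
  by apply: eq_bigr => s _; rewrite !mxE scalerDl scalerA.
pose hL := GRing.isLinear.Build _ _ _ _ h0 h0L.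
pose h : {linear _ -> _} := HB.pack h0 hL.
exists h => [v|h' fh' u]; first exact: alternating_expand.
rewrite [u]row_sum_delta !linear_sum; apply: eq_bigr => s _.
by rewrite !linearZ /= -wedgev_basis -fh' /= -/(h _) alternating_expand.
Qed.

End Universal.

Lemma wedgev_mul v A : wedgev (v *m A) = wedgev v *m extmx A.
Proof.
rewrite (@alternating_expand _ (fun v => wedgev (v *m A))).
- apply/rowP=> t; rewrite summxE !mxE; apply: eq_bigr => s _.
  by rewrite !mxE.
- move=> B C D i0 b c hB hC hD.
  have row'M (M : 'M_(m, d)) : row' i0 (M *m A) = row' i0 M *m A.
    by apply/matrixP=> i j; rewrite !mxE; apply: eq_bigr => k _; rewrite mxE.
  apply: (wedgev_multilinear (i0 := i0)).
  + by rewrite !row_mul hB mulmxDl !scalemxAl.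
  + by rewrite !row'M hC.
  + by rewrite !row'M hD.
move=> B i1 i2 neq eqB; apply: (wedgev_alternating neq) => j; rewrite !mxE.
by apply: eq_bigr => k _; rewrite eqB.
Qed.

Lemma extmx1 : extmx 1%:M = 1%:M.
Proof.
by apply/row_matrixP=> s; rewrite rowK mulmx1 wedgev_basis row1.
Qed.

Lemma extmxM A B : extmx (A *m B) = extmx A *m extmx B.
Proof.
by apply/row_matrixP=> s; rewrite row_mul !rowK mulmxA wedgev_mul.
Qed.

End ExteriorPower.

Section Trace.
Variable C : numClosedFieldType.

Lemma trigP n (A : 'M[C]_n) :
  exists P T, [/\ P \in unitmx, is_trig_mx T & A = invmx P *m T *m P].
Proof.
have [|P Pu] := @cotrigonalization C n [:: A].
  by move=> B D; rewrite !inE => /eqP-> /eqP->.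
have Punit := unitarymx_unit Pu.
rewrite /= andbT /mxred.similar_to mxred.conjumx // => AP; exists P, (P *m A *m invmx P); split=> //.
by rewrite !mulmxA mulVmx // mul1mx mulmxKV.
Qed.

Lemma conj_powE n (P T : 'M[C]_n) j : P \in unitmx ->
  (invmx P *m T *m P) ^+ j = invmx P *m T ^+ j *m P.
Proof.
move=> Pu; elim: j => [|j IH]; first by rewrite !expr0 mulmx1 mulVmx.
by rewrite !exprS IH -!mulmxE !mulmxA mulmxK.
Qed.

Lemma trig_mul n (A B : 'M[C]_n) : is_trig_mx A -> is_trig_mx B ->
  is_trig_mx (A *m B) /\ forall i, (A *m B) i i = A i i * B i i.
Proof.
move=> /is_trig_mxP At /is_trig_mxP Bt; split.
  apply/is_trig_mxP => i j lt_ij; rewrite mxE big1 // => l _.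
  case: (ltnP i l) => [/At->|le_li]; first by rewrite mul0r.
  by rewrite (Bt l j) ?mulr0 // (leq_ltn_trans le_li).
move=> i; rewrite mxE (bigD1 i) //= big1 ?addr0 // => l neq.
case: (ltngtP i l) => [/At->|/Bt->|/val_inj eq_il]; rewrite ?mul0r ?mulr0 //.
by rewrite eq_il eqxx in neq.
Qed.

Lemma trig_pow n (A : 'M[C]_n) j : is_trig_mx A ->
  is_trig_mx (A ^+ j) /\ forall i, (A ^+ j) i i = A i i ^+ j.
Proof.
move=> At; elim: j => [|j [IHt IHd]].
  by rewrite expr0; split=> [|i]; rewrite ?scalar_mx_is_trig // mxE eqxx.
have [? E] := trig_mul At IHt; rewrite exprS -mulmxE; split=> // i.
by rewrite E IHd exprS.
Qed.

Lemma eigenvaluesP n (A : 'M[C]_n) : exists2 t : 'I_n -> C,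
  forall j, \tr (A ^+ j) = \sum_i t i ^+ j &
  \sum_(m < n.+1) \tr (extmx m A) = \prod_i (1 + t i)
  /\ \det (1%:M + A) = \prod_i (1 + t i).
Proof.
have [P [T [Pu Tt ->]]] := trigP A; exists (fun i => T i i) => [j|].
  rewrite conj_powE // mxtrace_mulC mulmxA mulmxV // mul1mx.
  by apply: eq_bigr => i _; case: (trig_pow j Tt) => _ ->.
split; last first.
  have -> : 1%:M + invmx P *m T *m P = invmx P *m (1%:M + T) *m P.
    by rewrite mulmxDr mulmxDl mulmx1 mulVmx.
  rewrite !det_mulmx mulrAC -det_mulmx mulVmx // det1 mul1r det_trig.
    by apply: eq_bigr => i _; rewrite !mxE eqxx.
  apply/is_trig_mxP => i j lt_ij; rewrite !mxE (is_trig_mxP Tt) // addr0.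
  by rewrite -val_eqE ltn_eqF.
have trT m : \tr (extmx m (invmx P *m T *m P))
    = \sum_(S : {set 'I_n} | #|S| == m) \prod_(i in S) T i i.
  rewrite !extmxM mxtrace_mulC mulmxA -extmxM mulmxV // extmx1 mul1mx.
  rewrite /mxtrace (big_sub [pred S : {set 'I_n} | #|S| == m]) /=.
  rewrite (reindex (@enum_val (msub n m) predT)) /=; last first.
    by apply: onW_bij; apply: enum_val_bij.
  apply: eq_bigr => s _; rewrite !mxE; set S := enum_val s.
  have -> : colsub (mcol S) (basis_rows C S *m T) = mxsub (mcol S) (mcol S) T.
    by apply/matrixP=> i j; rewrite mul_rowsub_mx mul1mx !mxE.
  rewrite det_trig; last first.
    apply/is_trig_mxP => i j lt_ij; rewrite mxE.
    by apply: (is_trig_mxP Tt); apply: mcol_mono.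
  rewrite [RHS]big_enum_val /=.
  rewrite (reindex (cast_ord (eqP (valP S)))) /=; last first.
    by exists (cast_ord (esym (eqP (valP S)))) => i _; rewrite ?cast_ordK ?cast_ordKV.
  by apply: eq_bigr => i _; rewrite !mxE /mcol cast_ordK.
rewrite (eq_bigr _ (fun (m : 'I_n.+1) _ => trT m)).
rewrite (eq_bigr (fun i => T i i + 1)) => [|i _]; last by rewrite addrC.
rewrite bigA_distr /=.
rewrite (partition_big (fun S : {set 'I_n} => inord #|S| : 'I_n.+1) xpredT) //=.
apply: eq_bigr => m _; apply: eq_big => S.
  rewrite -val_eqE /= inordK // ltnS.
  by rewrite -[X in (_ <= X)%N](card_ord n) max_card.
by move=> _; rewrite [LHS]big_mkcond.
Qed.

Lemma power_sums_perm n1 n2 (s : 'I_n1 -> C) (t : 'I_n2 -> C) :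
  (forall j, \sum_i s i ^+ j = \sum_i t i ^+ j) ->
  \prod_i (1 + s i) = \prod_i (1 + t i).
Proof.
move=> eq_st.
have eq_p (p : {poly C}) : \sum_i p.[s i] = \sum_i p.[t i].
  have E n (u : 'I_n -> C) : \sum_i p.[u i] = \sum_(j < size p) p`_j * \sum_i u i ^+ j.
    rewrite (eq_bigr _ (fun i _ => horner_coef p (u i))) exchange_big /=.
    by apply: eq_bigr => j _; rewrite mulr_sumr.
  by rewrite !E; apply: eq_bigr => j _; rewrite eq_st.
pose im n (u : 'I_n -> C) := [seq u i | i <- index_enum 'I_n].
pose ss := im _ s; pose ts := im _ t.
suff eq_perm : perm_eq ss ts.
  have : \prod_(x <- ss) (1 + x) = \prod_(x <- ts) (1 + x) by apply: perm_big.
  by rewrite !big_map.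
apply/allP => c _ /=; apply/eqP.
pose p := \prod_(z <- undup (ss ++ ts) | z != c) ('X - z%:P).
have pc : p.[c] != 0.
  rewrite horner_prod prodf_seq_neq0; apply/allP => z _; apply/implyP => zc.
  by rewrite hornerXsubC subr_eq0 eq_sym.
have pz z : z \in ss ++ ts -> z != c -> p.[z] = 0.
  move=> zin zc; apply/rootP; rewrite /p.
  rewrite -big_filter root_prod_XsubC mem_filter zc mem_undup //.
have E n (u : 'I_n -> C) : {subset im _ u <= ss ++ ts} ->
    \sum_i p.[u i] = p.[c] *+ count_mem c (im _ u).
  move=> sub; rewrite -sum1_count -sumrMnr big_map [RHS]big_mkcond /=.
  apply: eq_bigr => i _; case: eqP => [->|/eqP neq]; first by rewrite mulr1n.
  by rewrite pz // sub // map_f // mem_index_enum.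
have := eq_p p; rewrite !E; first last.
- by move=> z; rewrite mem_cat => ->.
- by move=> z; rewrite mem_cat orbC => ->.
rewrite -[LHS]mulr_natr -[RHS]mulr_natr => /(mulfI pc)/eqP.
by rewrite eqr_nat => /eqP.
Qed.
End Trace.

Section WedgeRepr.
Variables (F : fieldType) (gT : finGroupType) (G : {group gT}).

Lemma ext_mx_repr d (rG : mx_representation F G d) m :
  mx_repr G (fun g => extmx m (rG g)).
Proof.
by split=> [|x y Gx Gy]; rewrite ?repr_mx1 ?extmx1 // repr_mxM // extmxM.
Qed.

Definition ext_repr d (rG : mx_representation F G d) m :=
  MxRepresentation (ext_mx_repr rG m).

(* The exterior powers of degree m > dim V are 0 (msub is then empty).        *)
Definition wedge_repr (V : representation F G) : representation F G :=
  \big[dadd_grepr/grepr0]_(m < (rdegree V).+1) Representation (ext_repr V m).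

End WedgeRepr.

(* The group is the whole finGroupType G; ring operations are pointwise.      *)
Section ClassFunctions.
Variables (C : fieldType) (G : finGroupType).

Definition is_classfun : {pred {ffun G -> C}} :=
  [pred f : {ffun G -> C} | [forall x, forall y, f (x ^ y)%g == f x]].

Lemma is_classfunP (f : {ffun G -> C}) : reflect (forall x y, f (x ^ y)%g = f x) (f \in is_classfun).
Proof.
apply: (iffP forallP) => [H x y|H x]; first by have /forallP/(_ y)/eqP := H x.
by apply/forallP => y; apply/eqP.
Qed.

Lemma is_classfun_subring : subring_closed is_classfun.
Proof.
split=> [|f g /is_classfunP cf /is_classfunP cg|f g /is_classfunP cf /is_classfunP cg];
  by apply/is_classfunP => x y; rewrite !ffunE // cf cg.
Qed.

Record classfun := ClassFun {cfval :> {ffun G -> C}; _ : cfval \in is_classfun}.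

HB.instance Definition _ := [isSub for cfval].
HB.instance Definition _ := [Choice of classfun by <:].
HB.instance Definition _ := GRing.SubChoice_isSubPzRing.Build
  {ffun G -> C} is_classfun classfun is_classfun_subring.

Lemma classfunP (f g : classfun) : (forall x, f x = g x) -> f = g.
Proof. by move=> eq_fg; apply/val_inj/ffunP. Qed.

Lemma classfunJ (f : classfun) x y : f (x ^ y)%g = f x.
Proof. exact/is_classfunP/(valP f). Qed.

Fact Classfun_subproof (f : G -> C) :
  (forall x y, f (x ^ y)%g = f x) -> [ffun x => f x] \in is_classfun.
Proof. by move=> cf; apply/is_classfunP => x y; rewrite !ffunE. Qed.
Definition Classfun f cf : classfun := ClassFun (@Classfun_subproof f cf).

Lemma ClassfunE f cf x : @Classfun f cf x = f x.
Proof. exact: ffunE. Qed.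

Lemma cf0E x : (0 : classfun) x = 0. Proof. exact: ffunE. Qed.
Lemma cf1E x : (1 : classfun) x = 1. Proof. exact: ffunE. Qed.
Lemma cfDE (f g : classfun) x : (f + g) x = f x + g x. Proof. exact: ffunE. Qed.
Lemma cfNE (f : classfun) x : (- f) x = - f x. Proof. exact: ffunE. Qed.
Lemma cfME (f g : classfun) x : (f * g) x = f x * g x. Proof. exact: ffunE. Qed.

Fact classfun_mulC : commutative (@GRing.mul classfun).
Proof. by move=> f g; apply: classfunP => x; rewrite !cfME mulrC. Qed.
HB.instance Definition _ :=
  GRing.PzRing_hasCommutativeMul.Build classfun classfun_mulC.

Fact cf_scale_subproof a (f : classfun) x y : a * f (x ^ y)%g = a * f x.
Proof. by rewrite classfunJ. Qed.
Definition cf_scale a f := Classfun (cf_scale_subproof a f).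
Fact cf_scaleA a b f : cf_scale a (cf_scale b f) = cf_scale (a * b) f.
Proof. by apply: classfunP => x; rewrite !ClassfunE mulrA. Qed.
Fact cf_scale1 : left_id 1 cf_scale.
Proof. by move=> f; apply: classfunP => x; rewrite !ClassfunE mul1r. Qed.
Fact cf_scaleDr : right_distributive cf_scale +%R.
Proof. by move=> a f g; apply: classfunP => x; rewrite !(ClassfunE, cfDE) mulrDr. Qed.
Fact cf_scaleDl f : {morph cf_scale^~ f : a b / a + b}.
Proof. by move=> a b; apply: classfunP => x; rewrite !(ClassfunE, cfDE) mulrDl. Qed.
HB.instance Definition _ := GRing.Zmodule_isLmodule.Build C classfun
  cf_scaleA cf_scale1 cf_scaleDr cf_scaleDl.

Lemma cfZE a (f : classfun) x : (a *: f) x = a * f x.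
Proof. exact: ClassfunE. Qed.

Fact rchar_subproof (V : representation C [set: G]) x y : \tr (V (x ^ y)%g) = \tr (V x).
Proof. by rewrite conjgE repr_mxM ?inE // mxtrace_mulC -repr_mxM ?inE // mulgK. Qed.
Definition rchar V : classfun := Classfun (rchar_subproof V).

Fact adams_subproof j (f : classfun) x y : f ((x ^ y) ^+ j)%g = f (x ^+ j)%g.
Proof. by rewrite -conjXg classfunJ. Qed.
Definition adams j f : classfun := Classfun (adams_subproof j f).

Lemma rchar0 : rchar grepr0 = 0.
Proof. by apply: classfunP => x; rewrite cf0E ClassfunE mxtrace1. Qed.

Lemma rcharD V W : rchar (dadd_grepr V W) = rchar V + rchar W.
Proof. by apply: classfunP => x; rewrite !(ClassfunE, cfDE) mxtrace_block. Qed.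

Lemma rcharM (V W : representation C [set: G]) :
  rchar (Representation (prod_repr V W)) = rchar V * rchar W.
Proof. by apply: classfunP => x; rewrite !(ClassfunE, cfME) mxtrace_prod. Qed.

Lemma rchar_sum n (r : 'I_n -> representation C [set: G]) :
  rchar (\big[dadd_grepr/grepr0]_(i < n) r i) = \sum_(i < n) rchar (r i).
Proof. exact: (big_morph rchar rcharD rchar0). Qed.

(* Virtual representations are identified with virtual characters, i.e., with *)
(* a subring of the ring of class functions.                                  *)
Definition is_virtual : {pred classfun} :=
  fun f => `[< exists V W : representation C [set: G], f = rchar V - rchar W >].

Lemma is_virtualP f :
  reflect (exists V W, f = rchar V - rchar W) (f \in is_virtual).
Proof. exact: asboolP. Qed.

Lemma is_virtual_rchar V : rchar V \in is_virtual.
Proof. by apply/is_virtualP; exists V, grepr0; rewrite rchar0 subr0. Qed.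

Lemma is_virtual_subring : subring_closed is_virtual.
Proof.
split=> [|_ _ /is_virtualP[V [W ->]] /is_virtualP[V' [W' ->]]
         |_ _ /is_virtualP[V [W ->]] /is_virtualP[V' [W' ->]]].
- have triv : mx_repr [set: G] (fun _ : G => 1%:M : 'M[C]_1).
    by split=> // x y _ _; rewrite mulmx1.
  suff -> : 1 = rchar (Representation (MxRepresentation triv)).
    exact: is_virtual_rchar.
  by apply: classfunP => x; rewrite cf1E ClassfunE mxtrace1.
- apply/is_virtualP; exists (dadd_grepr V W'), (dadd_grepr W V').
  by rewrite !rcharD opprB addrACA -opprD.
pose T := fun V W : representation C [set: G] => Representation (prod_repr V W).
apply/is_virtualP.
exists (dadd_grepr (T V V') (T W W')), (dadd_grepr (T V W') (T W V')).
by rewrite !rcharD !rcharM; ring.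
Qed.

Record vrep := VRep {vrep_val :> classfun; _ : vrep_val \in is_virtual}.
HB.instance Definition _ := [isSub for vrep_val].
HB.instance Definition _ := [Choice of vrep by <:].
HB.instance Definition _ := GRing.SubChoice_isSubComPzRing.Build
  classfun is_virtual vrep is_virtual_subring.

Definition vclass V : vrep := VRep (is_virtual_rchar V).

Definition is_wedge (w : vrep -> classfun) :=
  [/\ w 0 = 1, forall x y, w (x + y) = w x * w y
    & forall V, w (vclass V) = rchar (wedge_repr V)].

End ClassFunctions.

Section WedgeExistence.
Variables (C : numClosedFieldType) (G : finGroupType).
Local Notation repr := (representation C [set: G]).
Hypothesis oddG : odd #|G|.

Lemma rchar_wedge (V : repr) g : rchar (wedge_repr V) g = \det (1%:M + V g).
Proof.
rewrite rchar_sum.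
have E n (h : 'I_n -> classfun C G) : (\sum_i h i) g = \sum_i h i g.
  by elim/big_rec2: _ => [|i x y _ <-]; rewrite ?cf0E ?cfDE.
rewrite E; have [t _ [eq_tr ->]] := eigenvaluesP (V g); rewrite -eq_tr.
by apply: eq_bigr => m _; rewrite ClassfunE.
Qed.

Lemma rchar_wedgeD (V W : repr) :
  rchar (wedge_repr (dadd_grepr V W)) = rchar (wedge_repr V) * rchar (wedge_repr W).
Proof.
apply: classfunP => g; rewrite cfME !rchar_wedge /=.
by rewrite scalar_mx_block add_block_mx !addr0 det_ublock.
Qed.

Lemma repr_pow (V : repr) g j : V (g ^+ j)%g = V g ^+ j.
Proof.
elim: j => [|j IH]; first by rewrite expg0 repr_mx1.
by rewrite expgS repr_mxM ?inE // IH exprS.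
Qed.

Lemma rchar_wedge_neq0 (V : repr) g : rchar (wedge_repr V) g != 0.
Proof.
rewrite rchar_wedge; apply/negP => /det0P[v v_neq0].
rewrite mulmxDr mulmx1 addrC => /eqP; rewrite addr_eq0 => /eqP vV.
have vVj j : v *m V g ^+ j = (-1) ^+ j *: v.
  elim: j => [|j IH]; first by rewrite mulmx1 scale1r.
  by rewrite exprSr -mulmxE mulmxA IH -scalemxAl vV scalerN -scaleNr exprS mulN1r.
have := vVj #|G|; rewrite -repr_pow -cardsT expg_cardG ?inE // repr_mx1 mulmx1.
rewrite cardsT -signr_odd oddG expr1 scaleN1r => /eqP.
rewrite -subr_eq0 opprK -mulr2n -scaler_nat scaler_eq0 pnatr_eq0 /=.
by rewrite (negPf v_neq0).
Qed.

Lemma rchar_wedge_inj (V W : repr) :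
  rchar V = rchar W -> rchar (wedge_repr V) = rchar (wedge_repr W).
Proof.
move=> eqVW; apply: classfunP => g; rewrite !rchar_wedge.
have [s trV [_ ->]] := eigenvaluesP (V g).
have [t trW [_ ->]] := eigenvaluesP (W g).
apply: power_sums_perm => j; rewrite -trV -trW.
have := congr1 (fun f : classfun C G => f (g ^+ j)%g) eqVW.
by rewrite !ClassfunE !repr_pow.
Qed.

Lemma vrepP (x : vrep C G) : exists V W : repr, x = rchar V - rchar W :> classfun C G.
Proof. exact/is_virtualP/(valP x). Qed.

Lemma is_wedge_exists_unique : exists! w : vrep C G -> classfun C G, is_wedge w.
Proof.
pose V x := sval (cid (vrepP x)).
pose W x := sval (cid (svalP (cid (vrepP x)))).
have xVW (x : vrep C G) : x = rchar (V x) - rchar (W x) :> classfun C G.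
  exact: svalP (cid (svalP (cid (vrepP x)))).
have quotJ (U U' : repr) x y :
    rchar (wedge_repr U) (x ^ y)%g / rchar (wedge_repr U') (x ^ y)%g
  = rchar (wedge_repr U) x / rchar (wedge_repr U') x by rewrite !classfunJ.
pose w x := Classfun (quotJ (V x) (W x)).
have wE (x : vrep C G) (U U' : repr) : x = rchar U - rchar U' :> classfun C G ->
    forall g, w x g = rchar (wedge_repr U) g / rchar (wedge_repr U') g.
  move=> xE g; rewrite ClassfunE; apply/eqP.
  rewrite eqr_div ?rchar_wedge_neq0 // -!cfME -!rchar_wedgeD; apply/eqP.
  congr (fun_of_fin (cfval _) g); apply: rchar_wedge_inj; rewrite !rcharD.
  have := etrans (esym (xVW x)) xE => /eqP; rewrite subr_eq addrAC.
  by rewrite -subr_eq opprK => /eqP.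
exists w; split.
  split=> [|x y|U].
  - apply: classfunP => g; rewrite (wE _ grepr0 grepr0) ?subrr //.
    by rewrite divff ?cf1E ?rchar_wedge_neq0.
  - apply: classfunP => g.
    rewrite (wE _ (dadd_grepr (V x) (V y)) (dadd_grepr (W x) (W y))); last first.
      by rewrite !rcharD opprD addrACA -!xVW.
    by rewrite !rchar_wedgeD !(cfME, ClassfunE) invfM mulrACA.
  apply: classfunP => g; rewrite (wE _ U grepr0); last by rewrite rchar0 subr0.
  by rewrite [X in _ / X]rchar_wedge det_mx00 divr1.
move=> w' [w'0 w'D w'E]; apply/funext => x; apply: classfunP => g.
have xE : vclass (V x) = x + vclass (W x).
  by apply: val_inj; rewrite [RHS]/= xVW subrK.
have := w'E (V x); rewrite xE w'D w'E => /(congr1 (fun f : classfun C G => f g)).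
by rewrite cfME => H; rewrite [LHS]ClassfunE -H mulfK ?rchar_wedge_neq0.
Qed.

Definition wedge : vrep C G -> classfun C G := sval (cid is_wedge_exists_unique).

Lemma wedgeP : is_wedge wedge.
Proof. by case: (svalP (cid is_wedge_exists_unique)). Qed.

End WedgeExistence.

Section Analysis.
Variable R : realType.

(* A conditionally convergent series for u > 0. *)
Definition altH (u : R) : R :=
  limn (series (fun m : nat => (-1) ^+ m / (m%:R + u))).

Definition wedge_coef (k j : nat) : R :=
  (-1) ^+ j.+1 * (altH (j%:R / k%:R) / k%:R).

(* e ^ (x + i y) = e ^ x (cos y + i sin y) *)
Definition expC (z : R[i]) : R[i] :=
  Complex (expR (complex.Re z) * cos (complex.Im z))
          (expR (complex.Re z) * sin (complex.Im z)).

Variable G : finGroupType.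

Fact cf_exp_subproof (f : classfun R[i] G) x y : expC (f (x ^ y)%g) = expC (f x).
Proof. by rewrite classfunJ. Qed.
Definition cf_exp f : classfun R[i] G := Classfun (cf_exp_subproof f).

End Analysis.

(* Main.v *)
(* Since the wedge operation is characterized by its values on actual         *)
(* representations, and both sides turn sums into products, the formula       *)
(* reduces, eigenvalue by eigenvalue, to                                      *)
(*      1 + z = exp (\sum_(1 <= j <= k) c_j z^j)     for z^k = 1, k odd.      *)
(* As k is odd, grouping the terms of the series of log(1 + z) by the residue *)
(* of their degree mod k turns that series into this sum. To avoid both       *)
(* Abel's theorem and complex logarithms, put                                 *)
(*      p_N(t) = \sum_(1 <= n <= k N) (-1)^(n+1) (z t)^n / n                  *)
(*      g_N(t) = exp(- p_N(t)) (1 + z t).                                     *)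
(* Then g_N' = exp(- p_N) z (-t)^(k N), and p_N is bounded on [0, 1] uniformly *)
(* in N because its residue classes are alternating sums, so that             *)
(* g_N(1) - g_N(0) = O(1 / N); let N tend to infinity.                        *)
Require Import Defs.
From mathcomp Require Import all_boot all_order all_algebra all_fingroup.
From mathcomp Require Import cyclic mxrepresentation character reals complex.
From mathcomp Require Import boolp classical_sets functions interval_inference.
From mathcomp Require Import topology normedtype.
From mathcomp Require Import sequences derive realfun exp trigo.
From mathcomp Require Import ring lra.
Set Implicit Arguments.
Unset Strict Implicit.
Unset Printing Implicit Defensive.
Import Order.TTheory GRing.Theory Num.Theory.
Import numFieldNormedType.Exports.
Local Open Scope ring_scope.
Local Open Scope complex_scope.

(** At g, the wedge of an actual representation V has character det(1 + V g), the product of the 1 +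
    t_i over the eigenvalues t_i of V g, while the Adams exponent at g is the sum over i and j of
    c_j t_i^j. Since t_i^k = 1, [expC_wedge_coef] turns the exponential of this sum into the same
    product. The right-hand side thus satisfies [is_wedge], and [is_wedge_exists_unique] extends the
    equality to virtual representations. The analysis behind [expC_wedge_coef] rests on
    [horner_logpoly_bound] (uniform bound), [cvg_logpoly1] (origin of the c_j) and
    [expR_rotation_loglim] (passage to the limit), all in real and imaginary parts. *)

(** * Alternating sums and convergence of the series H *)

Section AlternatingSeries.
Local Open Scope classical_set_scope.
Variable R : realType.
Implicit Type u : nat -> R.

(** Splitting off the first term leaves u_0 minus an alternating sum that lies between 0 and u_1 by
    induction. *)
Lemma alternating_sum_bound u N :
  (forall m, 0 <= u m) -> (forall m, u m.+1 <= u m) ->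
  0 <= \sum_(m < N) (-1) ^+ m * u m <= u 0%N.
Proof.
elim: N u => [|N IHN] u u_ge0 u_dec; first by rewrite big_ord0 lexx u_ge0.
have /andP[ge0 le1] := IHN (u \o succn) (fun m => u_ge0 _) (fun m => u_dec _).
rewrite big_ord_recl /= mul1r.
under eq_bigr do rewrite /bump /= add1n exprS mulN1r mulNr.
rewrite sumrN subr_ge0 lerBlDr lerDl ge0 andbT.
exact: le_trans le1 (u_dec _).
Qed.

Lemma is_cvg_alternating_series u :
  (forall m, 0 <= u m) -> (forall m, u m.+1 <= u m) -> u @ \oo --> 0 ->
  cvgn (series (fun m => (-1) ^+ m * u m)).
Proof.
move=> u_ge0 u_dec u0; apply/cauchy_cvgP/cauchy_seriesP => e e_gt0.
have [N _ uN] : \forall n \near \oo, `|u n| < e by move/cvgr0Pnorm_lt: u0; exact.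
exists ([set n | (N <= n)%N], setT) => [|[n p] [/= le_Nn _]].
  by split; [exists N|exists 0%N].
have [le_pn|/ltnW le_np] := leqP p n; first by rewrite big_geq ?normr0.
(* Up to sign, a block starting at n is an alternating sum with first term u n, hence is at most u
   n. *)
rewrite -{1}[n]add0n big_addn big_mkord.
under eq_bigr => i _ do rewrite exprD [_ ^+ i * _]mulrC -mulrA.
rewrite -mulr_sumr normrM normrX normrN1 expr1n mul1r.
have /andP[ge0 le1] := @alternating_sum_bound (fun i => u (i + n)%N) (p - n)
  (fun m => u_ge0 _) (fun m => u_dec _).
rewrite ger0_norm //; apply: le_lt_trans le1 _.
by apply: le_lt_trans (uN n le_Nn); rewrite add0n ler_norm.
Qed.

Lemma is_cvg_altH (v : R) : 0 < v ->
  cvgn (series (fun m : nat => (-1) ^+ m / (m%:R + v))).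
Proof.
move=> v_gt0; apply: (@is_cvg_alternating_series (fun m => (m%:R + v)^-1)).
- by move=> m; rewrite invr_ge0 addr_ge0 // ltW.
- by move=> m; rewrite lef_pV2 ?posrE ?ltr_wpDl // lerD2r ler_nat.
rewrite -cvg_shiftS; apply/(squeeze_cvgr _ (cvg_cst 0) cvg_harmonic).
apply: nearW => m /=; rewrite invr_ge0 addr_ge0 ?ler0n ?(ltW v_gt0) //=.
by rewrite lef_pV2 ?posrE ?ltr_wpDl ?ltr0n // lerDl ltW.
Qed.

End AlternatingSeries.

(** * Increments of functions whose derivative is dominated by a power *)

Section PowerDominated.
Local Open Scope classical_set_scope.
Variable R : realType.

(** The mean value theorem, applied after subtracting the primitive of K t^n, replaces integration;
    the factor 1 / (n + 1) is what tends to 0 later. *)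
Lemma derive_le_pow_increment (f df : R -> R) (K : R) (n : nat) :
  (forall t, is_derive t (1 : R) f (df t)) ->
  (forall t, 0 <= t <= 1 -> df t <= K * t ^+ n) ->
  f 1 - f 0 <= K / n.+1%:R.
Proof.
move=> fdf df_le; pose h : R -> R := f - K / n.+1%:R \*: (id ^+ n.+1).
have hdh t : is_derive t (1 : R) h (df t - K * t ^+ n).
  apply: is_derive_eq; congr (_ - _); rewrite /GRing.scale /= mulr1 mulrA.
  by rewrite mulfVK ?pnatr_eq0.
have [|c /itvP c01] := @MVT_segment _ h _ 0 1 ler01 (fun t _ => hdh t).
  apply: derivable_within_continuous => t _.
  by have [] := hdh t.
rewrite /h !fctE /= expr1n expr0n /= scaler0 [_ *: 1]mulr1 !subr0 mulr1 addrAC => eqh.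
by rewrite -subr_le0 eqh subr_le0 df_le ?c01.
Qed.

Lemma derive_norm_pow_increment (f df : R -> R) (K : R) (n : nat) :
  (forall t, is_derive t (1 : R) f (df t)) ->
  (forall t, 0 <= t <= 1 -> `|df t| <= K * t ^+ n) ->
  `|f 1 - f 0| <= K / n.+1%:R.
Proof.
move=> fdf df_le; rewrite ler_norml lerNl opprB; apply/andP; split.
  have := @derive_le_pow_increment (- f) (fun t => - df t) K n _ _.
  rewrite !fctE opprK [_ + f 0]addrC; apply=> t t01.
  by apply: le_trans (df_le t t01); rewrite -normrN ler_norm.
apply: (derive_le_pow_increment fdf) => t t01.
by apply: le_trans (df_le t t01); rewrite ler_norm.
Qed.

End PowerDominated.

(** * Taylor polynomials of log(1 + z t) at a root of unity z of odd order *)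

Section LogPolynomial.
Local Open Scope classical_set_scope.
Variable R : realType.
Implicit Types (x y : nat -> R) (p r u v : {poly R}).

(* For x n = Re (z ^+ n.+1), the real part of the Taylor polynomial of degree *)
(* M of log(1 + z t); likewise for the imaginary part.                        *)
Definition logpoly x M : {poly R} :=
  \sum_(n < M) ((-1) ^+ n * (x n / n.+1%:R)) *: 'X^(n.+1).

Lemma horner_logpoly x M t :
  (logpoly x M).[t] = \sum_(n < M) (-1) ^+ n * (x n * (t ^+ n.+1 / n.+1%:R)).
Proof.
rewrite horner_sum; apply: eq_bigr => n _.
by rewrite hornerZ hornerXn -!mulrA [_^-1 * _]mulrC.
Qed.

Lemma horner_deriv_logpoly x M t :
  (logpoly x M)^`().[t] = \sum_(n < M) x n * (- t) ^+ n.
Proof.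
rewrite raddf_sum horner_sum; apply: eq_bigr => n _.
rewrite /= derivZ derivXn /= hornerZ hornerMn hornerXn [in RHS]exprNn.
rewrite -[t ^+ n *+ _]mulr_natr.
have : n.+1%:R != 0 :> R by rewrite pnatr_eq0.
by move: (n.+1%:R : R) => q q0; field.
Qed.

Lemma big_residue (F : nat -> R) k N :
  \sum_(n < k * N) F n = \sum_(j < k) \sum_(m < N) F (j + k * m)%N.
Proof.
elim: N => [|N IHN]; first by rewrite muln0 big_ord0 big1 // => j _; rewrite big_ord0.
rewrite mulnSr big_split_ord /= IHN -big_split /=.
by apply: eq_bigr => j _; rewrite big_ord_recr /= addnC.
Qed.

Variables (k : nat).
Hypothesis odd_k : odd k.

Let k_gt0 : (0 < k)%N. Proof. exact: odd_gt0. Qed.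

(** As k is odd, (-1)^(j + k m) = (-1)^j (-1)^m: each residue class mod k is again an alternating
    sum. *)
Lemma horner_logpoly_residue x N t : (forall n, x (n + k)%N = x n) ->
  (logpoly x (k * N)).[t] = \sum_(j < k) (-1) ^+ j * x j *
     \sum_(m < N) (-1) ^+ m * (t ^+ (j + k * m).+1 / (j + k * m).+1%:R).
Proof.
move=> xk; rewrite horner_logpoly.
rewrite (big_residue (fun n => (-1) ^+ n * (x n * (t ^+ n.+1 / n.+1%:R)))).
apply: eq_bigr => j _.
rewrite mulr_sumr; apply: eq_bigr => m _.
rewrite exprD exprM -[in (-1) ^+ k]signr_odd odd_k expr1.
suff -> : x (j + k * m)%N = x j by rewrite mulrACA !mulrA.
by elim: (val m) => [|i IHi]; rewrite ?muln0 ?addn0 // mulnSr addnA xk.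
Qed.

Lemma horner_logpoly_bound x N t : (forall n, x (n + k)%N = x n) ->
  0 <= t <= 1 -> `|(logpoly x (k * N)).[t]| <= \sum_(j < k) `|x j|.
Proof.
move=> xk /andP[t_ge0 t_le1]; rewrite horner_logpoly_residue //.
apply: le_trans (ler_norm_sum _ _ _) _; apply: ler_sum => j _.
rewrite normrM normrM normrX normrN1 expr1n mul1r ler_piMr //.
pose w m := t ^+ (j + k * m).+1 / (j + k * m).+1%:R.
have w_ge0 m : 0 <= w m by rewrite divr_ge0 ?exprn_ge0.
have w_dec m : w m.+1 <= w m.
  have le_m : (j + k * m <= j + k * m.+1)%N by rewrite leq_add2l leq_pmul2l.
  apply: ler_pM; rewrite ?exprn_ge0 ?invr_ge0 //.
    by apply: ler_wiXn2l => //.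
  by rewrite lef_pV2 ?posrE ?ltr0n // ler_nat.
have /andP[ge0 le1] := alternating_sum_bound N w_ge0 w_dec.
rewrite ger0_norm //; apply: le_trans le1 _.
rewrite /w ler_pdivrMr ?ltr0n // mul1r.
by apply: le_trans (exprn_ile1 _ t_ge0 t_le1) _; rewrite ler1n.
Qed.

(** The index is shifted because x j stands for a part of z^(j+1). *)
Definition loglim x : R := \sum_(j < k) wedge_coef R k j.+1 * x j.

Lemma cvg_logpoly1 x : (forall n, x (n + k)%N = x n) ->
  (logpoly x (k * N)).[1] @[N --> \oo] --> loglim x.
Proof.
move=> xk; under eq_cvg do rewrite horner_logpoly_residue //.
apply: cvg_big => [|j _]; first exact: add_continuous.
rewrite /wedge_coef !exprS !mulN1r opprK -mulrA [_ * x j]mulrC mulrA.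
apply: cvgM; first exact: cvg_cst.
have v_gt0 : 0 < j.+1%:R / k%:R :> R by rewrite divr_gt0 ?ltr0n.
rewrite [altH _ / _]mulrC.
apply: cvg_trans (cvgM (cvg_cst (k%:R^-1 : R)) (is_cvg_altH v_gt0)).
apply: near_eq_cvg; apply: nearW => N /=.
rewrite /series /= big_mkord mulr_sumr; apply: eq_bigr => m _.
(* 1 / (j + 1 + k m) = (1 / k) / (m + (j + 1) / k), which is the general term of H((j + 1) / k) / k
   up to sign. *)
rewrite expr1n mulrCA; congr (_ * _).
rewrite mul1r -invfM mulrDr mulrC -addSn natrD natrM mulrCA divff ?mulr1 ?pnatr_eq0 -?lt0n //.
by rewrite addrC mulrC.
Qed.

(** The function is the real part of exp(-(p + i r)) (u + i v); the two brackets are the real and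
    imaginary parts of (u + i v)' - (p + i r)' (u + i v). *)
Lemma is_derive_expR_rotation p r u v (t : R) :
  is_derive t (1 : R)
    (fun t => expR (- p.[t]) * (u.[t] * cos r.[t] + v.[t] * sin r.[t]))
    (expR (- p.[t]) * ((u^`() - p^`() * u + r^`() * v).[t] * cos r.[t]
                     + (v^`() - p^`() * v - r^`() * u).[t] * sin r.[t])).
Proof.
have -> : (fun t => expR (- p.[t]) * (u.[t] * cos r.[t] + v.[t] * sin r.[t])) =
    (expR \o horner (- p)) *
      (horner u * (cos \o horner r) + horner v * (sin \o horner r)).
  by apply/funext => s; rewrite !fctE /= hornerN.
apply: is_derive_eq; rewrite !fctE /= /GRing.scale /= derivN !(hornerD, hornerN, hornerM); ring.
Qed.

(* If x, y are the real and imaginary parts of z ^+ n.+1, then [g N t] below  *)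
(* is the real part of exp(- p_N(t)) (u + i v); the choices 1 + z t and       *)
(* - i (1 + z t) of u + i v give the real and imaginary parts of g_N(t).      *)
Lemma expR_rotation_loglim x y u v (a b : R) :
  (forall n, x (n + k)%N = x n) -> (forall n, y (n + k)%N = y n) ->
  (forall N t,
     (u^`() - (logpoly x (k * N))^`() * u + (logpoly y (k * N))^`() * v).[t]
       = a * (- t) ^+ (k * N)) ->
  (forall N t,
     (v^`() - (logpoly x (k * N))^`() * v - (logpoly y (k * N))^`() * u).[t]
       = b * (- t) ^+ (k * N)) ->
  expR (- loglim x) * (u.[1] * cos (loglim y) + v.[1] * sin (loglim y)) = u.[0].
Proof.
move=> xk yk Hu Hv.
pose g N t := expR (- (logpoly x (k * N)).[t])
  * (u.[t] * cos (logpoly y (k * N)).[t] + v.[t] * sin (logpoly y (k * N)).[t]).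
have g0 N : g N 0 = u.[0].
  have l0 z : (logpoly z (k * N)).[0] = 0.
    rewrite horner_logpoly big1 // => n _.
    by rewrite expr0n mul0r !mulr0.
  by rewrite /g !l0 oppr0 expR0 cos0 sin0 mulr0 addr0 mul1r mulr1.
(* The first factor bounds exp(-p_N) on [0, 1] for every N; the second bounds |a cos + b sin|. *)
pose K := expR (\sum_(j < k) `|x j|) * (`|a| + `|b|).
have gK N : `|g N 1 - u.[0]| <= K * harmonic N.
  rewrite -(g0 N); apply: (@le_trans _ _ (K / (k * N).+1%:R)); last first.
    rewrite ler_wpM2l ?mulr_ge0 ?expR_ge0 ?addr_ge0 //.
    by rewrite /harmonic lef_pV2 ?posrE ?ltr0n // ler_nat ltnS leq_pmull.
  apply: (derive_norm_pow_increment (fun t => is_derive_expR_rotation _ _ u v t)).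
  move=> t t01.
  rewrite Hu Hv normrM (ger0_norm (expR_ge0 _)) /K -[leRHS]mulrA.
  apply: ler_pM => //.
    rewrite ler_expR; apply: le_trans (horner_logpoly_bound N xk t01).
    by rewrite -normrN ler_norm.
  have -> s c q : a * q * c + b * q * s = (a * c + b * s) * q by move=> *; ring.
  have /andP[t_ge0 _] := t01; rewrite normrM normrX normrN (ger0_norm t_ge0).
  rewrite ler_wpM2r ?exprn_ge0 //.
  apply: le_trans (ler_normD _ _) _; rewrite !normrM.
  apply: lerD; apply: ler_piMr => //.
    by rewrite ler_norml cos_geN1 cos_le1.
  by rewrite ler_norml sin_geN1 sin_le1.
have cvg_u0 : g N 1 @[N --> \oo] --> u.[0].
  apply: (cvg_sub0 _ (cvg_cst u.[0])); apply: norm_cvg0.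
  apply: (squeeze_cvgr _ (cvg_cst 0)); last first.
    by rewrite -(mulr0 K); apply: (cvgM (cvg_cst K) (@cvg_harmonic R)).
  by apply: nearW => N; rewrite normr_ge0 gK.
have cvg_lim : g N 1 @[N --> \oo] -->
    expR (- loglim x) * (u.[1] * cos (loglim y) + v.[1] * sin (loglim y)).
  have cx := cvg_logpoly1 xk; have cy := cvg_logpoly1 yk.
  apply: cvgM; first by apply: cvg_comp (cvgN cx) _; exact: continuous_expR.
  apply: cvgD; apply: cvgM; try exact: cvg_cst.
    by apply: cvg_comp cy _; exact: continuous_cos.
  by apply: cvg_comp cy _; exact: continuous_sin.
exact: (cvg_unique _ cvg_lim cvg_u0).
Qed.

End LogPolynomial.

(** * The identity 1 + z = exp(sum of c_j z^j) and eigenvalues of finite order *)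

Section ComplexExponential.
Variable R : realType.
Implicit Types (z w : R[i]).

Lemma complex_sumE n (f : 'I_n -> R[i]) :
  \sum_i f i = (\sum_i complex.Re (f i)) +i* (\sum_i complex.Im (f i)).
Proof.
by elim/big_rec3: _ => // i r p z _ ->; case: (f i).
Qed.

Lemma expC0 : expC 0 = 1 :> R[i].
Proof. by rewrite /expC /= expR0 cos0 sin0 mulr0 mulr1. Qed.

Lemma expCD z w : expC (z + w) = expC z * expC w.
Proof.
case: z w => [a b] [c d]; rewrite /expC /= expRD cosD sinD.
by apply/eqP; rewrite eq_complex /=; apply/andP; split; apply/eqP; ring.
Qed.

Lemma expC_sum n (f : 'I_n -> R[i]) : expC (\sum_i f i) = \prod_i expC (f i).
Proof. exact: (big_morph _ expCD expC0). Qed.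

(** The sum is p_N'(t), so this gives z - (1 + z t) p_N'(t) = z (-t)^(k N), the cancellation that
    makes g_N' small. *)
Lemma geometric_sum_root k z (t : R) N : z ^+ k = 1 ->
  (1 + z * t%:C) * \sum_(n < k * N) z ^+ n.+1 * ((- t)%:C) ^+ n
    = z * (1 - ((- t) ^+ (k * N))%:C).
Proof.
move=> zk; set s := (- t)%:C; have -> : z * t%:C = - (z * s).
  by rewrite /s rmorphN mulrN opprK.
under eq_bigr do rewrite exprS -mulrA -exprMn.
rewrite -mulr_sumr mulrCA -opprB mulNr -subrX1 opprB exprMn exprM zk expr1n mul1r.
by rewrite rmorphXn.
Qed.

Lemma expC_wedge_coef k z : odd k -> z ^+ k = 1 ->
  expC (\sum_(j < k) (wedge_coef R k j.+1)%:C * z ^+ j.+1) = 1 + z.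
Proof.
move=> odd_k zk.
pose x n := complex.Re (z ^+ n.+1); pose y n := complex.Im (z ^+ n.+1).
have xk n : x (n + k)%N = x n by rewrite /x -addSn exprD zk mulr1.
have yk n : y (n + k)%N = y n by rewrite /y -addSn exprD zk mulr1.
have -> : \sum_(j < k) (wedge_coef R k j.+1)%:C * z ^+ j.+1
        = loglim k x +i* loglim k y.
  rewrite complex_sumE; congr Complex; apply: eq_bigr => j _;
    by rewrite /x /y; case: (z ^+ j.+1) => a b /=; rewrite mul0r ?subr0 ?addr0.
set a := complex.Re z; set b := complex.Im z.
have ReIm N t : let q := (- t) ^+ (k * N) in
    let A := (logpoly x (k * N))^`().[t] in let B := (logpoly y (k * N))^`().[t] in
    (1 + a * t) * A - b * t * B = a * (1 - q) /\ (1 + a * t) * B + b * t * A = b * (1 - q).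
  move=> q A B; have := geometric_sum_root t N zk.
  have -> : \sum_(n < k * N) z ^+ n.+1 * (- t)%:C ^+ n = A +i* B.
    rewrite complex_sumE /A /B !horner_deriv_logpoly; congr Complex;
      apply: eq_bigr => n _; rewrite -rmorphXn /x /y; case: (z ^+ n.+1) => c d /=;
      by rewrite mulr0 ?subr0 ?add0r ?addr0 1?mulrC.
  rewrite -/q /a /b; case: (z) => c d /eqP.
  rewrite eq_complex /= => /andP[/eqP E1 /eqP E2].
  by split; [apply: etrans (etrans E1 _) | apply: etrans (etrans E2 _)]; ring.
(* u + i v = 1 + z t. *)
pose u : {poly R} := 1 + a *: 'X; pose v : {poly R} := b *: 'X.
have du : u^`() = a%:P by rewrite derivD derivZ derivX derivC add0r alg_polyC.
have dv : v^`() = b%:P by rewrite derivZ derivX alg_polyC.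
have uE t : u.[t] = 1 + a * t by rewrite hornerD hornerZ hornerX hornerC.
have vE t : v.[t] = b * t by rewrite hornerZ hornerX.
clearbody u v.
have re1 : expR (- loglim k x) * (u.[1] * cos (loglim k y) + v.[1] * sin (loglim k y))
           = u.[0].
  apply: (expR_rotation_loglim odd_k xk yk (a := a) (b := b)) => N t;
  have [] := ReIm N t; rewrite !(hornerD, hornerN, hornerM) ?du ?dv hornerC uE vE;
  move: ((- t) ^+ (k * N)) => q E1 E2.
    by lra.
  by lra.
have im1 : expR (- loglim k x) * (v.[1] * cos (loglim k y) + (- u).[1] * sin (loglim k y))
           = v.[0].
  apply: (expR_rotation_loglim odd_k xk yk (a := b) (b := - a)) => N t;
  have [] := ReIm N t; rewrite !(derivN, hornerD, hornerN, hornerM) ?du ?dv hornerC uE vE;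
  move: ((- t) ^+ (k * N)) => q E1 E2.
    by lra.
  by lra.
move: re1 im1; rewrite !(hornerN, uE, vE) !mulr0 addr0 !mulr1 expRN.
set E := expR _; set c := cos _; set s := sin _ => re1 im1.
have E_neq0 : E != 0 by rewrite gt_eqF ?expR_gt0.
have cs : c ^+ 2 + s ^+ 2 = 1 by exact: cos2Dsin2.
(* Together [re1] and [im1] say (1 + z)(c - i s) = E; multiplying by c + i s gives the claim. *)
have {}re1 : (1 + a) * c + b * s = E by rewrite -[LHS](mulVKf E_neq0) re1 mulr1.
have {}im1 : b * c - (1 + a) * s = 0.
  by rewrite -[LHS](mulVKf E_neq0) -mulNr im1 mulr0.
have -> : 1 + z = (1 + a) +i* b.
  rewrite [z]complexE; apply/eqP; rewrite eq_complex /= -/a -/b.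
  by apply/andP; split; apply/eqP; ring.
rewrite /expC /= -/E -/c -/s.
apply/eqP; rewrite eq_complex /=; apply/andP; split; apply/eqP.
  have -> : E * c = (1 + a) * (c ^+ 2 + s ^+ 2) + s * (b * c - (1 + a) * s).
    by rewrite -re1; ring.
  by rewrite cs im1 mulr0 mulr1 addr0.
have -> : E * s = b * (c ^+ 2 + s ^+ 2) - c * (b * c - (1 + a) * s).
  by rewrite -re1; ring.
by rewrite cs im1 mulr0 mulr1 subr0.
Qed.

(** The triangularization of [eigenvaluesP] is redone to keep the diagonal in hand: T^k = 1 forces
    its entries to be k-th roots of unity. *)
Lemma root_of_unity_eigenvalues d (A : 'M[R[i]]_d) k : A ^+ k = 1%:M ->
  exists t : 'I_d -> R[i], [/\ forall i, t i ^+ k = 1,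
    forall j, \tr (A ^+ j) = \sum_i t i ^+ j & \det (1%:M + A) = \prod_i (1 + t i)].
Proof.
have [P [T [Pu Tt ->]]] := trigP A; rewrite conj_powE // => Tk.
exists (fun i => T i i); split=> [i|j|].
- have [_ <-] := trig_pow k Tt.
  have -> : T ^+ k = 1%:M.
    by rewrite -[T ^+ k](mulKVmx Pu) -[invmx P *m _](mulmxK Pu) Tk mul1mx mulmxV.
  by rewrite mxE eqxx.
- rewrite conj_powE // mxtrace_mulC mulmxA mulmxV // mul1mx.
  by apply: eq_bigr => i _; have [_ ->] := trig_pow j Tt.
have -> : 1%:M + invmx P *m T *m P = invmx P *m (1%:M + T) *m P.
  by rewrite mulmxDr mulmxDl mulmx1 mulVmx.
rewrite !det_mulmx mulrAC -det_mulmx mulVmx // det1 mul1r det_trig.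
  by apply: eq_bigr => i _; rewrite !mxE eqxx.
apply/is_trig_mxP => i j lt_ij; rewrite !mxE (is_trig_mxP Tt) // addr0.
by rewrite -val_eqE ltn_eqF.
Qed.

End ComplexExponential.

(** * The exponential formula satisfies the characterization of the wedge *)

Section Wedge.
Variables (R : realType) (G : finGroupType).
Hypothesis oddG : odd #|G|.
Notation repr := (representation R[i] [set: G]).

Definition adams_sum (f : classfun R[i] G) : classfun R[i] G :=
  \sum_(1 <= j < #|G|.+1) (wedge_coef R #|G| j)%:C *: adams j f.

Lemma adams_sumE f g :
  adams_sum f g = \sum_(j < #|G|) (wedge_coef R #|G| j.+1)%:C * f (g ^+ j.+1)%g.
Proof.
have sumE n (h : 'I_n -> classfun R[i] G) : (\sum_i h i) g = \sum_i h i g.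
  by elim/big_rec2: _ => [|i x y _ <-]; rewrite ?cf0E ?cfDE.
rewrite /adams_sum big_add1 big_mkord sumE.
by apply: eq_bigr => j _; rewrite cfZE ClassfunE.
Qed.

Lemma cf_exp_adams_rchar (V : repr) :
  cf_exp (adams_sum (rchar V)) = rchar (wedge_repr V).
Proof.
apply: classfunP => g; rewrite ClassfunE adams_sumE rchar_wedge.
have [|t [tk trV ->]] := @root_of_unity_eigenvalues R _ (V g) #|G|.
  by rewrite -repr_pow -cardsT expg_cardG ?inE // repr_mx1.
(* The trace of V at g^j is the sum of the t_i^j, so the exponent splits into one sum per
   eigenvalue. *)
under [in LHS]eq_bigr do rewrite ClassfunE repr_pow trV mulr_sumr.
rewrite exchange_big expC_sum; apply: eq_bigr => i _.
exact: expC_wedge_coef.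
Qed.

Lemma is_wedge_cf_exp_adams : is_wedge (fun x : vrep R[i] G => cf_exp (adams_sum x)).
Proof.
split=> [|x y|V]; last exact: cf_exp_adams_rchar.
  apply: classfunP => g; rewrite ClassfunE adams_sumE big1 ?expC0 ?cf1E // => j _.
  by rewrite cf0E mulr0.
apply: classfunP => g; rewrite cfME !ClassfunE !adams_sumE -expCD -big_split /=.
by congr expC; apply: eq_bigr => j _; rewrite cfDE mulrDr.
Qed.

End Wedge.

Theorem theorem4p1 (R : realType) (G : finGroupType) (oddG : odd #|G|)
    (x : vrep R[i] G) :
  let k := #|G| in
  wedge oddG x =
    cf_exp (\sum_(1 <= j < k.+1) (wedge_coef R k j)%:C *: adams j x).
Proof.
have [w [_ w_uniq]] := is_wedge_exists_unique R[i] oddG.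
by rewrite /= -(w_uniq _ (wedgeP _ oddG)) (w_uniq _ (is_wedge_cf_exp_adams _ oddG)).
Qed.
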